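(* In the setting below, fix a strategy $\pi$, thresholds $0=v_0\le v_1\le\dots\le v_{n_p}=1$ and $\eta\in(0,1)$, and let $K^\pi_k$ and $H^{q,\pi,\epsilon}_{k,i}$ be as defined below. Let $k\in\{0,\dots,N\}$ and $q\in Q$, and assume that for every $k'\in\{k,\dots,N-1\}$ and every cell $q''\in Q$ the sets $H^{q'',\pi,\epsilon}_{k',i}$, $i=1,\dots,n_p$, are pairwise disjoint. Then $$\inf_{x\in q}V^\pi_k(x)\ \ge\ K^\pi_k(q).$$
   Context: Setting (BNN dynamical system). Let $f^w:\mathbb{R}^n\times\mathbb{R}^c\to\mathbb{R}^n$ be a neural network with parameter vector $w\in\mathbb{R}^{n_w}$, measurable in $(w,x,u)$, and let $p_{\mathbf{w}}(w\mid\mathcal{D})$ be a probability density on $\mathbb{R}^{n_w}$. Fix $\sigma>0$. The posterior predictive density is $p(\bar x\mid(x,u),\mathcal{D})=\int_{\mathbb{R}^{n_w}}\mathcal{N}(\bar x\mid f^w(x,u),\sigma^2 I)\,p_{\mathbf{w}}(w\mid\mathcal{D})\,dw$, with $\mathcal{N}(\cdot\mid m,\sigma^2I)$ the Gaussian density on $\mathbb{R}^n$. Let $\mathcal{U}\subseteq\mathbb{R}^c$ be compact; a strategy is a sequence $\pi=(\pi_k)_k$ of measurable maps $\pi_k:\mathbb{R}^n\to\mathcal{U}$. Let $\mathrm{G},\mathrm{S}\subseteq\mathbb{R}^n$ be measurable, disjoint, and $N\in\mathbb{N}$. Value functions: $V^\pi_N(x)=\mathbf{1}_{\mathrm{G}}(x)$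 and for $0\le k<N$, $V^\pi_k(x)=\mathbf{1}_{\mathrm{G}}(x)+\mathbf{1}_{\mathrm{S}}(x)\int_{\mathbb{R}^n}V^\pi_{k+1}(\bar x)\,p(\bar x\mid(x,\pi_k(x)),\mathcal{D})\,d\bar x$, for $x\in\mathbb{R}^n$. Abstraction: $Q=\{q_1,\dots,q_{n_q}\}$ is a partition of $\mathrm{S}\cup\mathrm{G}$ into measurable cells, each cell contained either in $\mathrm{G}$ or in $\mathrm{S}$; $z:\mathrm{S}\cup\mathrm{G}\to Q$ maps a state to the cell containing it. For $q\in Q$, $\mathbf{1}_{\mathrm{G}}(q)=1$ if $q\subseteq\mathrm{G}$ and $0$ otherwise; similarly $\mathbf{1}_{\mathrm{S}}(q)$. For a function $K:Q\to[0,1]$ write $\tilde K(\bar x)=K(z(\bar x))$ if $\bar x\in\mathrm{S}\cup\mathrm{G}$ and $\tilde K(\bar x)=0$ otherwise. Noise truncation: $\eta\in(0,1)$ and $\epsilon=\sqrt{2\sigma^2}\,\mathrm{erf}^{-1}(\eta)$, so that a scalar $\mathcal{N}(0,\sigma^2)$ variable lies in $[-\epsilon,\epsilon]$ with probability $\eta$. Discretised lower bounds: $K^\pi_N(q)=\mathbf{1}_{\mathrm{G}}(q)$ and for $0\le k<N$ $$K^\pi_k(q)=\mathbf{1}_{\mathrm{G}}(q)+\mathbf{1}_{\mathrm{S}}(q)\sum_{i=1}^{n_p}v_{i-1}\,R(q,k,\pi,i),\qquad R(q,k,\pi,i)=\eta^n\int_{H^{q,\pi,\epsilon}_{k,i}}p_{\mathbf{w}}(w\mid\mathcal{D})\,dw,$$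 where the projecting weight set is $$H^{q,\pi,\epsilon}_{k,i}=\big\{w\in\mathbb{R}^{n_w}:\ \forall x\in q,\ \forall\gamma\in[-\epsilon,\epsilon]^n,\ v_{i-1}\le \tilde K^\pi_{k+1}\big(f^w(x,\pi_k(x))+\gamma\big)\le v_i\big\}$$ (assumed measurable). *)

(* Defs.v *)
From HB Require Import structures.
From mathcomp Require Import all_boot all_order all_algebra.
From mathcomp Require Import all_classical all_reals all_analysis.
Set Implicit Arguments. Unset Strict Implicit. Unset Printing Implicit Defensive.
Import Order.TTheory GRing.Theory Num.Theory.
Import numFieldNormedType.Exports.
Local Open Scope classical_set_scope.
Local Open Scope ring_scope.

Section BNN.
Context {R : realType}.

(** Lebesgue integral over R^n (states as n.-tuples) of a function with
    values in \bar R, written as the iterated one-dimensional Lebesgue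
    integral (for the non-negative integrands used below this is the
    integral w.r.t. n-dimensional Lebesgue measure, by Tonelli). *)
Fixpoint lebint (n : nat) : (n.-tuple R -> \bar R) -> \bar R :=
  match n return (n.-tuple R -> \bar R) -> \bar R with
  | 0 => fun g => g [tuple]
  | m.+1 => fun g =>
      (\int[@lebesgue_measure R]_(x in [set: R])
          lebint (fun t : m.-tuple R => g [tuple of x :: t]))%E
  end.

Definition tadd (n : nat) (a b : n.-tuple R) : n.-tuple R :=
  [tuple tnth a j + tnth b j | j < n].

(** identification of R^c (tuples) with row vectors, to speak of compactness *)
Definition row_of_tuple (c : nat) (u : c.-tuple R) : 'rV[R]_c :=
  \row_j tnth u j.

(** Gaussian density N(xb | m, sigma^2 I) on R^n (isotropic: product of
    the one-dimensional normal densities of standard deviation sigma) *)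
Definition gauss_dens (n : nat) (sigma : R) (m xb : n.-tuple R) : R :=
  \prod_(j < n) normal_pdf (tnth m j) sigma (tnth xb j).

Definition erf (x : R) : R :=
  2 / Num.sqrt pi *
  (if 0 <= x then Rintegral (@lebesgue_measure R) `[0, x] (fun t => expR (- t ^+ 2))
   else - Rintegral (@lebesgue_measure R) `[x, 0] (fun t => expR (- t ^+ 2))).

Definition erfinv (y : R) : R := xget 0 [set x | erf x = y].

Definition eps_of (sigma eta : R) : R := Num.sqrt (2 * sigma ^+ 2) * erfinv eta.

Variables (n c nw nq np N : nat) (sigma eta : R).
Variables (f : nw.-tuple R -> n.-tuple R -> c.-tuple R -> n.-tuple R)
          (pw : nw.-tuple R -> R)
          (pi : nat -> n.-tuple R -> c.-tuple R)
          (G S : set (n.-tuple R))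
          (cell : 'I_nq -> set (n.-tuple R))
          (z : n.-tuple R -> 'I_nq)
          (v : nat -> R).

Definition pred_dens (x : n.-tuple R) (u : c.-tuple R) (xb : n.-tuple R) : \bar R :=
  lebint (fun w : nw.-tuple R => (gauss_dens sigma (f w x u) xb * pw w)%:E).

(** value functions: Vaux m = V_{N-m} *)
Fixpoint Vaux (m : nat) : n.-tuple R -> \bar R :=
  match m with
  | 0 => fun x => (\1_G x)%:E
  | m'.+1 => fun x =>
      let k := (N - m'.+1)%N in
      ((\1_G x)%:E + (\1_S x)%:E *
         lebint (fun xb => Vaux m' xb * pred_dens x (pi k x) xb))%E
  end.

Definition V (k : nat) : n.-tuple R -> \bar R := Vaux (N - k).

Definition indG (q : 'I_nq) : R := (asbool (cell q `<=` G))%:R.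
Definition indS (q : 'I_nq) : R := (asbool (cell q `<=` S))%:R.

Definition Ktilde (Kn : 'I_nq -> \bar R) (xb : n.-tuple R) : \bar R :=
  if asbool ((S `|` G) xb) then Kn (z xb) else 0%E.

(** the projecting weight set H^{q,pi,eps}_{k,i} (with Kn playing the role of K_{k+1}) *)
Definition Hset (Kn : 'I_nq -> \bar R) (k : nat) (q : 'I_nq) (i : nat)
  : set (nw.-tuple R) :=
  [set w | forall x, cell q x -> forall gam : n.-tuple R,
      (forall j, - eps_of sigma eta <= tnth gam j <= eps_of sigma eta) ->
      ((v i.-1)%:E <= Ktilde Kn (tadd (f w x (pi k x)) gam) <= (v i)%:E)%E].

Definition Rterm (Kn : 'I_nq -> \bar R) (k : nat) (q : 'I_nq) (i : nat) : \bar R :=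
  ((eta ^+ n)%:E *
     lebint (fun w => (\1_(Hset Kn k q i) w * pw w)%:E))%E.

(** discretised lower bounds: Kaux m = K_{N-m} *)
Fixpoint Kaux (m : nat) : 'I_nq -> \bar R :=
  match m with
  | 0 => fun q => (indG q)%:E
  | m'.+1 => fun q =>
      let k := (N - m'.+1)%N in
      ((indG q)%:E + (indS q)%:E *
         \sum_(1 <= i < np.+1) ((v i.-1)%:E * Rterm (Kaux m') k q i))%E
  end.

Definition K (k : nat) : 'I_nq -> \bar R := Kaux (N - k).

End BNN.
Arguments row_of_tuple {R c}.

(* Main.v *)
Require Import Defs.
From HB Require Import structures.
From mathcomp Require Import all_boot all_order all_algebra.
From mathcomp Require Import all_classical all_reals all_analysis.
From mathcomp Require Import measurable_realfun ring lra.
Import Order.TTheory GRing.Theory Num.Theory.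
Import numFieldNormedType.Exports.
Local Open Scope classical_set_scope.
Local Open Scope ring_scope.

(* Backward induction on the time step.  For x in a cell q of S, bounding the
   value function at step k+1 from below by the piecewise constant K~ and
   exchanging the integrals over states and weights (Tonelli) gives
   V_k(x) >= int_w p(w) E[K~(f^w(x, u) + noise)].  If w lies in H_i, then K~ is
   at least v_(i-1) on the cube of half-width eps centred at f^w(x, u), which
   has Gaussian mass eta^n, so the inner expectation is at least
   v_(i-1) eta^n; the H_i being disjoint, these contributions add up to
   K_k(q). *)

Set Implicit Arguments.
Unset Strict Implicit.

(** * Tonelli calculus for the iterated integral *)

Section lebint_theory.
Context {R : realType}.
Local Open Scope ereal_scope.
Local Notation mu := (@lebesgue_measure R).

(* Unlike [ge0_le_integral], this needs no measurability: the integral of a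
   non-negative function is a supremum over the simple functions below it. *)
Lemma le_integral_nonmeasurable (f g : R -> \bar R) :
  (forall x, 0 <= f x) -> (forall x, f x <= g x) ->
  \int[mu]_x f x <= \int[mu]_x g x.
Proof.
move=> f0 fg; have g0 x : 0 <= g x by exact: le_trans (fg x).
rewrite !ge0_integralTE//; apply: ereal_sup_le => _ [h /= hf <-].
by exists h => //= x; exact: le_trans (fg x).
Qed.

Lemma lebint_ge0 n (f : n.-tuple R -> \bar R) :
  (forall x, 0 <= f x) -> 0 <= lebint f.
Proof.
elim: n f => [|n IH] f f0 //=.
by apply: integral_ge0 => x _; exact: IH.
Qed.

Lemma le_lebint n (f g : n.-tuple R -> \bar R) :
  (forall x, 0 <= f x) -> (forall x, f x <= g x) -> lebint f <= lebint g.
Proof.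
elim: n f g => [|n IH] f g f0 fg //=.
apply: le_integral_nonmeasurable => x; first exact: lebint_ge0.
exact: IH.
Qed.

Lemma eq_lebint n (f g : n.-tuple R -> \bar R) :
  f =1 g -> lebint f = lebint g.
Proof. by move=> /funext ->. Qed.

Lemma measurable_pcons d (T : measurableType d) n :
  measurable_fun [set: T * R * n.-tuple R]
    (fun p => (p.1.1, [tuple of p.1.2 :: p.2])).
Proof.
apply/measurable_fun_pairP; split.
  exact: (measurableT_comp measurable_fst measurable_fst).
apply: (@measurable_cons _ _ (T * R * n.-tuple R)%type R) => //.
exact: (measurableT_comp measurable_snd measurable_fst).
Qed.

(** The parameter space [T] is quantified inside the induction: the first coordinate of the tuple is
    moved into the parameter, giving [T * R]. The remaining one-dimensional integral is then
    measurable by the Fubini-Tonelli theorem. *)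
Lemma measurable_lebint d (T : measurableType d) n
    (F : T * n.-tuple R -> \bar R) :
  measurable_fun [set: T * n.-tuple R] F -> (forall p, 0 <= F p) ->
  measurable_fun [set: T] (fun t => lebint (fun x => F (t, x))).
Proof.
elim: n d T F => [|n IH] d T F mF F0 /=.
  by apply: (measurableT_comp mF); exact: measurable_pair2.
apply: (measurable_fun_fubini_tonelli_F (m2 := mu) (fun p : T * R =>
    lebint (fun s : n.-tuple R => F (p.1, [tuple of p.2 :: s])))).
  apply: (IH _ (T * R)%type (fun p : T * R * n.-tuple R =>
    F (p.1.1, [tuple of p.1.2 :: p.2]))) => //.
  by apply: (measurableT_comp mF); exact: measurable_pcons.
by move=> p; exact: lebint_ge0.
Qed.

Lemma measurable_tcons n :
  measurable_fun [set: R * n.-tuple R] (fun p => [tuple of p.1 :: p.2]).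
Proof. exact: (@measurable_cons _ _ (R * n.-tuple R)%type R). Qed.

Lemma measurable_tcons1 n (x : R) :
  measurable_fun [set: n.-tuple R] (fun s => [tuple of x :: s]).
Proof. exact: (@measurable_cons _ _ (n.-tuple R)%type R). Qed.

Lemma measurable_lebint_head n (f : n.+1.-tuple R -> \bar R) :
  measurable_fun [set: n.+1.-tuple R] f -> (forall x, 0 <= f x) ->
  measurable_fun [set: R]
    (fun x => lebint (fun s : n.-tuple R => f [tuple of x :: s])).
Proof.
move=> mf f0.
apply: (@measurable_lebint _ R n (fun p => f [tuple of p.1 :: p.2])) => //.
exact: (measurableT_comp mf (@measurable_tcons n)).
Qed.

Lemma lebintZl n (f : n.-tuple R -> \bar R) (c : \bar R) :
  measurable_fun [set: n.-tuple R] f -> (forall x, 0 <= f x) -> 0 <= c ->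
  lebint (fun x => c * f x) = c * lebint f.
Proof.
elim: n f => [//|n IH] f mf f0 c0 /=.
rewrite -ge0_integralZl//; last 2 first.
- exact: measurable_lebint_head.
- by move=> x _; exact: lebint_ge0.
apply: eq_integral => x _; rewrite IH//.
exact: (measurableT_comp mf (@measurable_tcons1 n x)).
Qed.

Lemma lebint_sum n (I : Type) (s : seq I) (F : I -> n.-tuple R -> \bar R) :
  (forall i, measurable_fun [set: n.-tuple R] (F i)) -> (forall i x, 0 <= F i x) ->
  lebint (fun x => \sum_(i <- s) F i x) = \sum_(i <- s) lebint (F i).
Proof.
elim: n F => [//|n IH] F mF F0 /=.
rewrite -ge0_integral_sum//; last 2 first.
- by move=> i; exact: measurable_lebint_head.
- by move=> i x _; exact: lebint_ge0.
apply: eq_integral => x _; rewrite IH// => i.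
exact: (measurableT_comp (mF i) (@measurable_tcons1 n x)).
Qed.

(** The variable [y] is carried past the coordinates of [x] one at a time: two-dimensional Tonelli
    for the first coordinate, the induction hypothesis for the others. *)
Lemma lebint_integral_swap n (F : R * n.-tuple R -> \bar R) :
  measurable_fun [set: R * n.-tuple R] F -> (forall p, 0 <= F p) ->
  \int[mu]_y lebint (fun x => F (y, x)) =
  lebint (fun x => \int[mu]_y F (y, x)).
Proof.
elim: n F => [//|n IH] F mF F0 /=.
rewrite (fubini_tonelli (m1 := mu) (m2 := mu) (fun p : R * R =>
  lebint (fun s : n.-tuple R => F (p.1, [tuple of p.2 :: s]))))//=; last 2 first.
- apply: (@measurable_lebint _ (R * R)%type n (fun p : R * R * n.-tuple R =>
   F (p.1.1, [tuple of p.1.2 :: p.2]))) => //.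
  exact: (measurableT_comp mF (@measurable_pcons _ R n)).
- by move=> p; exact: lebint_ge0.
apply: eq_integral => x _.
apply: (IH (fun p => F (p.1, [tuple of x :: p.2]))) => //.
apply: (measurableT_comp mF); apply: measurable_fun_pair => //.
exact: (measurableT_comp (@measurable_tcons1 n x) measurable_snd).
Qed.

Lemma lebint_swap m n (F : m.-tuple R * n.-tuple R -> \bar R) :
  measurable_fun [set: m.-tuple R * n.-tuple R] F -> (forall p, 0 <= F p) ->
  lebint (fun y => lebint (fun x => F (y, x))) =
  lebint (fun x => lebint (fun y => F (y, x))).
Proof.
elim: m F => [//|m IH] F mF F0 /=.
have mcons : measurable_fun [set: R * n.-tuple R * m.-tuple R] (fun p =>
    F ([tuple of p.1.1 :: p.2], p.1.2)).
  apply: (measurableT_comp mF); apply/measurable_fun_pairP; split.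
  - apply: (@measurable_cons _ _ (R * n.-tuple R * m.-tuple R)%type R) => //.
    exact: (measurableT_comp measurable_fst measurable_fst).
  - exact: (measurableT_comp measurable_snd measurable_fst).
(* On the right-hand side the first coordinate of [y] is brought outside the integral over [x]; the
   induction hypothesis then applies with that coordinate frozen. *)
rewrite -(@lebint_integral_swap n (fun p => lebint (fun y : m.-tuple R =>
    F ([tuple of p.1 :: y], p.2)))); last 2 first.
- exact: (@measurable_lebint _ (R * n.-tuple R)%type m _ mcons).
- by move=> p; exact: lebint_ge0.
apply: eq_integral => x _ /=.
apply: (IH (fun p => F ([tuple of x :: p.1], p.2))) => //.
apply: (measurableT_comp mF); apply: measurable_fun_pair => //.
exact: (measurableT_comp (@measurable_tcons1 m x) measurable_fst).
Qed.

(** The factor of the first coordinate is constant for the inner integrals, so it comes out and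
    leaves a product of the same shape. This turns the mass of a box into a power of a
    one-dimensional mass. *)
Lemma lebint_prod n (h : 'I_n -> R -> R) (a : R) :
  (forall j, measurable_fun [set: R] (h j)) -> (forall j x, (0 <= h j x)%R) ->
  (forall j, \int[mu]_x (h j x)%:E = a%:E) ->
  lebint (fun x => (\prod_(j < n) h j (tnth x j))%:E) = (a ^+ n)%:E.
Proof.
elim: n h => [|n IH] h mh h0 ha /=; first by rewrite big_ord0.
have mprod : measurable_fun [set: n.-tuple R]
    (fun s => (\prod_(j < n) h (lift ord0 j) (tnth s j))%:E).
  apply/measurable_EFinP; apply: measurable_prod => j _.
  exact: (measurableT_comp (mh _) (measurable_tnth j)).
under eq_integral.
  move=> x _.
  under eq_lebint.
    move=> s; rewrite big_ord_recl tnth0 EFinM.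
    under eq_bigr do rewrite tnthS.
    over.
  rewrite lebintZl; [|exact: mprod|by move=> s; rewrite lee_fin prodr_ge0
                    |by rewrite lee_fin h0].
  rewrite (IH (fun j => h (lift ord0 j)))//.
  over.
rewrite ge0_integralZr//.
- by rewrite ha -EFinM exprS.
- by apply/measurable_EFinP; exact: mh.
- by move=> x _; rewrite lee_fin h0.
(* The tuple has at least one coordinate here, so [a] is the integral of a non-negative function. *)
- have a0 : 0 <= a%:E by rewrite -(ha ord0) integral_ge0// => x _; rewrite lee_fin h0.
  by rewrite lee_fin exprn_ge0.
Qed.

End lebint_theory.

(** * The error function, its inverse, and the mass of a Gaussian interval *)

Section erf_theory.
Context {R : realType}.
Local Notation mu := (@lebesgue_measure R).

(** Intermediate value theorem for [P x], the integral of [exp(-t^2)] over [[0, x]], with target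
    [v], the value that [erf x = y] requires of it. *)
Lemma exists_erf_eq (y : R) : 0 < y < 1 -> exists2 x : R, 0 < x & erf x = y.
Proof.
move=> /andP[y0 y1].
pose P (x : R) := gauss_integral_proof.integral0_gauss x.
have P_ge0 x : 0 <= P x by exact: gauss_integral_proof.integral0_gauss_ge0.
pose v : R := y * (Num.sqrt pi / 2).
have sqrtpi0 : 0 < Num.sqrt (pi : R) by rewrite sqrtr_gt0 pi_gt0.
have v0 : 0 < v by rewrite mulr_gt0// divr_gt0.
have [M M0 vM] : exists2 M : R, 0 < M & v < P M.
  (* [P M ^+ 2] tends to [pi / 4], and [v ^+ 2] is [y ^+ 2 * (pi / 4)] with [y < 1], so some [M]
     overshoots the target. *)
  have v2 : v ^+ 2 < pi / 4.
    rewrite /v exprMn expr_div_n sqr_sqrtr ?pi_ge0//.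
    rewrite (_ : 2 ^+ 2 = 4 :> R) ?expr2 -?natrM//.
    rewrite -[ltRHS]mul1r ltr_pM2r ?divr_gt0 ?pi_gt0//.
    by rewrite mulr_ilt1// ltW.
  have := @gauss_integral_proof.cvg_integral0_gauss_sqr R.
  move=> /cvgr_gt => /(_ _ v2) H.
  near (pinfty_nbhs R) => M.
  exists M => //.
  have : v ^+ 2 < P M ^+ 2 by near: M; exact: H.
  by rewrite ltr_pXn2r// nnegrE// ltW.
have cP : {within `[0, M], continuous P}.
  apply: parameterized_integral_continuous; first exact: ltW.
  apply: continuous_compact_integrable; first exact: segment_compact.
  by apply: continuous_subspaceT; exact: continuous_gauss_fun.
have P0 : P 0 = 0 by rewrite /P /gauss_integral_proof.integral0_gauss set_itv1 Rintegral_set1.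
have [|c] := @IVT R P 0 M v (ltW M0) cP.
  by rewrite P0 minEle maxEle P_ge0 !ltW.
rewrite in_itv/= => /andP[c0 cM] Pc.
exists c.
  rewrite lt_neqAle c0 andbT; apply/eqP => c0'.
  by move: v0; rewrite -Pc -c0' P0 ltxx.
rewrite /erf c0.
have -> : Rintegral mu `[0, c] (fun t => expR (- t ^+ 2)) = v by exact: Pc.
by rewrite /v; field; rewrite gt_eqF.
Unshelve. all: end_near. Qed.

(** A preimage exists, so [xget] does not fall back on its default 0. Whichever preimage it picks is
    positive, because [erf] is at most 0 on non-positive arguments. *)
Lemma erfinv_spec (y : R) : 0 < y < 1 -> 0 < erfinv y /\ erf (erfinv y) = y.
Proof.
move=> y01; have [x x0 xy] := exists_erf_eq y01.
rewrite /erfinv; case: xgetP => [t _ /= ty|/(_ x)//].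
split=> //; rewrite ltNge; apply/negP => t0.
have /andP[y0 _] := y01.
move: ty; rewrite /erf; case: ifPn => [t0'|_].
  have -> : t = 0 by apply/eqP; rewrite eq_le t0 t0'.
  rewrite set_itv1 Rintegral_set1 mulr0 => ty.
  by rewrite -ty ltxx in y0.
move=> ty; move: y0; rewrite -ty ltNge => /negP; apply.
rewrite mulr_ge0_le0// ?divr_ge0// oppr_le0.
by apply: Rintegral_ge0 => //= r _; exact: expR_ge0.
Qed.

Lemma integral_gauss_itv_sym (e : R) : 0 < e ->
  (\int[mu]_(x in `[(- e)%R, e]) (gauss_fun x)%:E =
   (2 * Rintegral mu `[0%R, e] (@gauss_fun R))%:E)%E.
Proof.
move=> e0; have mg : measurable_fun [set: R] (fun x => (gauss_fun x)%:E).
  by apply/measurable_EFinP; exact: measurable_gauss_fun.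
(* The bound is written [- 0] to match the substitution [x -> - x], which maps the left half onto
   [[0, e]]; the integrand is even. *)
rewrite (_ : `[- e, e]%classic = `[- e, - 0]%classic `|` `]0, e]%classic); last first.
  by rewrite oppr0 -itv_bndbnd_setU//= bnd_simp ?oppr_le0 ltW.
rewrite ge0_integral_setU//=; last 3 first.
- exact: measurable_funTS.
- by move=> x _; rewrite lee_fin gauss_fun_ge0.
- apply/disj_setPS => x [] /=; rewrite !in_itv/= oppr0.
  by move=> /andP[_ x0] /andP[/lt_le_trans /(_ x0)]; rewrite ltxx.
rewrite integration_by_substitution_oppr ?ltW//; last first.
  by apply: continuous_subspaceT; exact: continuous_gauss_fun.
rewrite integral_itv_obnd_cbnd; last exact: measurable_funTS.
have -> : (\int[mu]_(x in `[0%R, e]) ((gauss_fun \o -%R) x)%:E =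
           \int[mu]_(x in `[0%R, e]) (gauss_fun x)%:E)%E.
  by apply: eq_integral => x _; rewrite /gauss_fun /= sqrrN.
rewrite mulrDl !mul1r EFinD /Rintegral fineK//.
apply: integrable_fin_num => //.
apply: continuous_compact_integrable; first exact: segment_compact.
by apply: continuous_subspaceT; exact: continuous_gauss_fun.
Qed.

(** Substitution [F x = (x - m) / a] with [a = sqrt(2 s^2)]: it sends the interval to [[- e, e]],
    and its constant derivative [1 / a] supplies the missing factor of the normal peak. *)
Lemma integral_normal_pdf_itv (m s e : R) : 0 < s -> 0 < e ->
  (\int[mu]_(x in `[(m - Num.sqrt (2 * s ^+ 2) * e)%R, (m + Num.sqrt (2 * s ^+ 2) * e)%R])
     (normal_pdf m s x)%:E = (erf e)%:E)%E.
Proof.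
move=> s0 e0; set a := Num.sqrt _.
have a0 : 0 < a by rewrite sqrtr_gt0 mulr_gt0// exprn_gt0.
pose F (x : R^o) : R^o := (x - m) / a.
have F'E : F^`()%classic = cst a^-1.
  apply/funext => x; rewrite /F derive1E deriveM// deriveD// derive_cst scaler0.
  by rewrite add0r derive_id derive_cst addr0 scaler1.
have dF x : derivable F x 1 by [].
have cF : continuous F.
  by move=> x; apply/differentiable_continuous/derivable1_diffP.
have sqrtpi0 : 0 < Num.sqrt (pi : R) by rewrite sqrtr_gt0 pi_gt0.
have -> : erf e = (Num.sqrt pi)^-1 * (2 * Rintegral mu `[0, e] (@gauss_fun R)).
  by rewrite /erf (ltW e0) mulrA [X in X * _]mulrC.
rewrite EFinM -integral_gauss_itv_sym//.
have [Fl Fr] : F (m - a * e) = - e /\ F (m + a * e) = e.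
  by split; rewrite /F; field; rewrite gt_eqF.
have := @integration_by_substitution_increasing R F gauss_fun
  (m - a * e) (m + a * e).
rewrite Fl Fr => ->; first last.
- by apply: continuous_subspaceT; exact: continuous_gauss_fun.
- by split => //; [apply: cvg_at_right_filter|apply: cvg_at_left_filter];
    exact: cF.
- by rewrite F'E; exact: is_cvg_cst.
- by rewrite F'E; exact: is_cvg_cst.
- by rewrite F'E => ? _; exact: cvg_cst.
- by move=> x y _ _ xy; rewrite /F ltr_pM2r ?invr_gt0// ltrD2r.
- by rewrite lerD2l (@le_trans _ _ 0)// ?oppr_le0 mulr_ge0// ltW.
rewrite F'E -ge0_integralZl_EFin ?invr_ge0 ?ltW//; last 2 first.
- by move=> x _; rewrite lee_fin mulr_ge0 ?gauss_fun_ge0//= invr_ge0 ltW.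
- apply/measurable_EFinP/measurable_funM => //.
  apply/measurable_funTS/measurableT_comp => //.
    exact: measurable_gauss_fun.
  exact: continuous_measurable_fun.
apply: eq_integral => x _; rewrite -EFinM; congr EFin.
rewrite normal_pdfE ?gt_eqF// /normal_fun /normal_peak /gauss_fun /= /F.
rewrite -[s ^+ 2 * pi *+ 2]mulrnAl -[s ^+ 2 *+ 2]mulr_natl sqrtrM; last first.
  by rewrite mulr_ge0// sqr_ge0.
have -> : - (x - m) ^+ 2 / (2 * s ^+ 2) = - ((x - m) / a) ^+ 2.
  by rewrite expr_div_n sqr_sqrtr ?mulNr// mulr_ge0// sqr_ge0.
change ((a * Num.sqrt pi)^-1 * expR (- ((x - m) / a) ^+ 2) =
  (Num.sqrt pi)^-1 * (expR (- ((x - m) / a) ^+ 2) * a^-1)).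
by rewrite invfM mulrAC mulrC [a^-1 * _]mulrC.
Qed.

End erf_theory.

(** * The isotropic Gaussian restricted to a cube *)

Section truncated_gaussian.
Context {R : realType}.
Local Notation mu := (@lebesgue_measure R).
Variables (sigma eta : R).
Hypotheses (sigma0 : 0 < sigma) (eta01 : 0 < eta < 1).

(** The coordinates are independent, and each one has mass [erf (erfinv eta) = eta] on its interval.
    The cube is encoded by one indicator per coordinate so that the integrand is a product. *)
Lemma lebint_gauss_box n (m : n.-tuple R) :
  lebint (fun xb : n.-tuple R => (\prod_(j < n)
    (\1_`[(tnth m j - eps_of sigma eta)%R, (tnth m j + eps_of sigma eta)%R]
       (tnth xb j) * normal_pdf (tnth m j) sigma (tnth xb j)))%:E)
  = (eta ^+ n)%:E.
Proof.
have [e0 erfe] := erfinv_spec eta01.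
apply: (@lebint_prod R n (fun j x =>
    \1_`[(tnth m j - eps_of sigma eta)%R, (tnth m j + eps_of sigma eta)%R] x
    * normal_pdf (tnth m j) sigma x)) => [j|j x|j].
- apply: measurable_funM; first exact: measurable_indic.
  exact: measurable_normal_pdf.
- by rewrite mulr_ge0// normal_pdf_ge0.
- rewrite -[RHS](congr1 EFin erfe) -(integral_normal_pdf_itv (tnth m j) sigma0 e0).
  rewrite [RHS]integral_mkcond; apply: eq_integral => x _.
  by rewrite patchE indicE; case: ifPn => _; rewrite ?mul1r ?mul0r.
Qed.

Lemma gauss_dens_ge0 n (m xb : n.-tuple R) : 0 <= gauss_dens sigma m xb.
Proof. by apply: prodr_ge0 => j _; exact: normal_pdf_ge0. Qed.

Lemma measurable_gauss_dens d (T : measurableType d) n (g h : T -> n.-tuple R) :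
  measurable_fun [set: T] g -> measurable_fun [set: T] h ->
  measurable_fun [set: T] (fun t => gauss_dens sigma (g t) (h t)).
Proof.
move=> mg mh; apply: measurable_prod => j _.
(* The mean varies with [t] as well, so the density is replaced by its closed formula, valid for
   nonzero [sigma] and visibly measurable in both arguments. *)
rewrite (_ : (fun t => _) = fun t => normal_peak sigma *
   expR (- (tnth (h t) j - tnth (g t) j) ^+ 2 / (sigma ^+ 2 *+ 2))); last first.
  by apply/funext => t; rewrite normal_pdfE ?gt_eqF.
apply: measurable_funM => //; apply: measurableT_comp => //.
apply: measurable_funM => //; apply: measurableT_comp => //.
apply: measurable_funX; apply: measurable_funB.
- exact: (measurableT_comp (measurable_tnth j) mh).
- exact: (measurableT_comp (measurable_tnth j) mg).
Qed.

End truncated_gaussian.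

(** * Comparison of the discretised bounds with the value functions *)

Section bnn_bounds.
Context {R : realType} {n c nw nq np N : nat} {sigma eta : R}.
Context {f : nw.-tuple R -> n.-tuple R -> c.-tuple R -> n.-tuple R}
  {pw : nw.-tuple R -> R} (pi : nat -> n.-tuple R -> c.-tuple R)
  {G S : set (n.-tuple R)} {cell : 'I_nq -> set (n.-tuple R)}
  {z : n.-tuple R -> 'I_nq} {v : nat -> R}.
Hypothesis mf : measurable_fun [set: nw.-tuple R * n.-tuple R * c.-tuple R]
  (fun p => f p.1.1 p.1.2 p.2).
Hypothesis mpw : measurable_fun [set: nw.-tuple R] pw.
Hypothesis pw0 : forall w, 0 <= pw w.
Hypothesis sigma0 : 0 < sigma.
Hypothesis mcell : forall j, measurable (cell j).
Hypothesis disj_cell : forall i j, i != j -> cell i `&` cell j = set0.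
Hypothesis cover_cell : \bigcup_j cell j = S `|` G.
Hypothesis cell_z : forall x, (S `|` G) x -> cell (z x) x.
Hypothesis eta01 : 0 < eta < 1.
Hypothesis v_ge0 : forall i, (i <= np)%N -> 0 <= v i.

Local Notation Hs := (Hset sigma eta f pi G S cell z v).
Local Notation Kt := (Ktilde G S z).

Lemma z_cell j x : cell j x -> z x = j.
Proof.
move=> xj; apply/eqP; apply: contrapT => /negP /disj_cell zj.
have xSG : (S `|` G) x by rewrite -cover_cell; exists j.
suff : set0 x by [].
by rewrite -zj; split => //; exact: cell_z.
Qed.

(** Exactly one cell contributes on [S] and [G], none outside. The map [z] carries no measurability
    assumption; this form derives that of [Ktilde] from the cells. *)
Lemma Ktilde_sum Kn x : Kt Kn x = (\sum_(j < nq) Kn j * (\1_(cell j) x)%:E)%E.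
Proof.
rewrite /Ktilde; case: asboolP => [xSG|nxSG].
  rewrite (bigD1 (z x))//= indicE mem_set ?mule1; last exact: cell_z.
  rewrite big1 ?adde0// => j jz; rewrite indicE memNset ?mule0// => /z_cell zj.
  by rewrite zj eqxx in jz.
rewrite big1// => j _; rewrite indicE memNset ?mule0// => xj; apply: nxSG.
by rewrite -cover_cell; exists j.
Qed.

Lemma measurable_Ktilde Kn : measurable_fun [set: n.-tuple R] (Kt Kn).
Proof.
rewrite (_ : Kt Kn = fun x => (\sum_(j < nq) Kn j * (\1_(cell j) x)%:E)%E).
  apply: emeasurable_sum => j _; apply: emeasurable_funM => //.
  by apply/measurable_EFinP; exact: measurable_indic.
by apply/funext => x; exact: Ktilde_sum.
Qed.

Lemma Ktilde_ge0 Kn x : (forall j, 0 <= Kn j)%E -> (0 <= Kt Kn x)%E.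
Proof. by rewrite /Ktilde => K0; case: asboolP. Qed.

Lemma pred_dens_ge0 x u xb : (0 <= pred_dens sigma f pw x u xb)%E.
Proof.
by apply: lebint_ge0 => w; rewrite lee_fin mulr_ge0// gauss_dens_ge0.
Qed.

Lemma V_ge0 m x : (0 <= Vaux N sigma f pw pi G S m x)%E.
Proof.
elim: m x => [|m IH] x /=; first by rewrite lee_fin.
rewrite adde_ge0 ?lee_fin// mule_ge0 ?lee_fin//.
by apply: lebint_ge0 => xb; rewrite mule_ge0// pred_dens_ge0.
Qed.

Lemma K_ge0 m q : (0 <= Kaux np N sigma eta f pw pi G S cell z v m q)%E.
Proof.
elim: m q => [|m IH] q /=; first by rewrite lee_fin /indG ler0n.
rewrite adde_ge0 ?lee_fin ?/indG ?ler0n// mule_ge0 ?lee_fin ?/indS ?ler0n//.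
rewrite big_nat_cond sume_ge0// => i /andP[/andP[i1 inp] _].
have /andP[/ltW eta0 _] := eta01.
rewrite mule_ge0 ?lee_fin ?v_ge0 ?(leq_trans (leq_pred i))//.
rewrite /Rterm mule_ge0 ?lee_fin ?exprn_ge0//.
by apply: lebint_ge0 => w; rewrite lee_fin mulr_ge0.
Qed.

(** The contribution of a single weight: [Ktilde] is at least [v i] on the cube around the network
    output, whose Gaussian mass is [eta ^+ n], and non-negative elsewhere. *)
Lemma lebint_Ktilde_ge Kn k q x w i : (forall j, 0 <= Kn j)%E ->
  cell q x -> (i < np)%N -> Hs Kn k q i.+1 w ->
  ((v i * eta ^+ n * pw w)%:E <= lebint (fun xb =>
     Kt Kn xb * (gauss_dens sigma (f w x (pi k x)) xb * pw w)%:E))%E.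
Proof.
move=> Kn0 qx inp Hw; set m := f w x (pi k x).
have vi0 := v_ge0 (ltnW inp).
(* Writing [eta ^+ n] as the integral of the truncated density makes both sides integrals over [xb],
   to be compared pointwise. *)
rewrite mulrAC EFinM -(lebint_gauss_box sigma0 eta01 m) -lebintZl; first last.
- by rewrite lee_fin mulr_ge0.
- move=> xb; rewrite lee_fin prodr_ge0// => j _.
  by rewrite mulr_ge0// normal_pdf_ge0.
- apply/measurable_EFinP; apply: measurable_prod => j _.
  apply: (measurableT_comp (f := fun y => \1_`[(tnth m j - eps_of sigma eta)%R,
     (tnth m j + eps_of sigma eta)%R] y * normal_pdf (tnth m j) sigma y)).
    apply: measurable_funM; first exact: measurable_indic.
    exact: measurable_normal_pdf.
  exact: measurable_tnth.
apply: le_lebint => xb.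
  rewrite lee_fin !mulr_ge0// prodr_ge0// => j _.
  by rewrite mulr_ge0// normal_pdf_ge0.
have [box|/existsNP[j jbox]] := pselect (forall j,
    `[(tnth m j - eps_of sigma eta)%R, (tnth m j + eps_of sigma eta)%R]%classic
      (tnth xb j)); last first.
  rewrite (bigD1 j)//= indicE memNset// !mul0r mule0.
  by rewrite mule_ge0 ?Ktilde_ge0// lee_fin mulr_ge0// gauss_dens_ge0.
under eq_bigr do rewrite indicE mem_set ?mul1r//.
rewrite -EFinM -mulrA [pw w * _]mulrC EFinM lee_wpmul2r//.
  by rewrite lee_fin mulr_ge0// gauss_dens_ge0.
(* The noise vector that carries the network output to [xb]; membership in the cube is what [Hset]
   demands of it. *)
pose gam : n.-tuple R := [tuple tnth xb j - tnth m j | j < n].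
have -> : xb = tadd m gam.
  by apply: eq_from_tnth => j; rewrite !tnth_mktuple addrC subrK.
have gambox j : - eps_of sigma eta <= tnth gam j <= eps_of sigma eta.
  rewrite tnth_mktuple; have := box j; rewrite /= in_itv/=.
  by move=> /andP[mxb xbm]; apply/andP; split; lra.
by have /andP[] := Hw x qx gam gambox.
Qed.

Lemma sum_Rterm_le Kn k q x : (forall j, 0 <= Kn j)%E -> cell q x ->
  (forall i, (1 <= i <= np)%N -> measurable (Hs Kn k q i)) ->
  (forall i j, (1 <= i <= np)%N -> (1 <= j <= np)%N -> i != j ->
     Hs Kn k q i `&` Hs Kn k q j = set0) ->
  (\sum_(1 <= i < np.+1)
      ((v i.-1)%:E * Rterm sigma eta f pw pi G S cell z v Kn k q i)
   <= lebint (fun xb => Kt Kn xb * pred_dens sigma f pw x (pi k x) xb))%E.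
Proof.
move=> Kn0 qx mH disjH.
have veta0 (i : 'I_np) : 0 <= v i * eta ^+ n.
  have /andP[/ltW eta0 _] := eta01.
  by rewrite mulr_ge0 ?exprn_ge0// v_ge0// ltnW.
have mfx : measurable_fun [set: nw.-tuple R] (fun w => f w x (pi k x)).
  apply: (measurableT_comp mf (g := fun w => (w, x, pi k x))).
  by apply: measurable_fun_pair => //; exact: measurable_fun_pair.
have gpw0 w xb : (0 <= (gauss_dens sigma (f w x (pi k x)) xb * pw w)%:E)%E.
  by rewrite lee_fin mulr_ge0// gauss_dens_ge0.
have mgpw : measurable_fun [set: n.-tuple R * nw.-tuple R] (fun p =>
    (gauss_dens sigma (f p.2 x (pi k x)) p.1 * pw p.2)%:E).
  apply/measurable_EFinP; apply: measurable_funM.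
    apply: measurable_gauss_dens => //.
    exact: (measurableT_comp mfx measurable_snd).
  exact: (measurableT_comp mpw measurable_snd).
(* Shift to indices from 0: the threshold becomes [v i] and the weight set the one of index
   [i.+1]. *)
rewrite big_add1 big_mkord /=.
under [leLHS]eq_bigr => i _.
  rewrite /Rterm muleA -EFinM -lebintZl; first last.
  - by rewrite lee_fin veta0.
  - by move=> w; rewrite lee_fin mulr_ge0.
  - apply/measurable_EFinP; apply: measurable_funM => //.
    by apply: measurable_indic; apply: mH; rewrite ltn_ord.
  over.
rewrite -(@lebint_sum R nw 'I_np _ (fun i w =>
    (v i * eta ^+ n)%:E * (\1_(Hs Kn k q i.+1) w * pw w)%:E)%E); last 2 first.
- move=> i; apply: emeasurable_funM => //; apply/measurable_EFinP.
  apply: measurable_funM => //.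
  by apply: measurable_indic; apply: mH; rewrite ltn_ord.
- by move=> i w; rewrite mule_ge0 ?lee_fin// mulr_ge0.
(* Tonelli puts the integral over weights outside, so both sides can be compared weight by
   weight. *)
have -> : lebint (fun xb => Kt Kn xb * pred_dens sigma f pw x (pi k x) xb)%E =
    lebint (fun w => lebint (fun xb => Kt Kn xb *
      (gauss_dens sigma (f w x (pi k x)) xb * pw w)%:E))%E.
  rewrite -(@lebint_swap R n nw (fun p => Kt Kn p.1 *
      (gauss_dens sigma (f p.2 x (pi k x)) p.1 * pw p.2)%:E)%E); last 2 first.
  - apply: emeasurable_funM => //.
    exact: (measurableT_comp (measurable_Ktilde Kn) measurable_fst).
  - by move=> p; rewrite mule_ge0// Ktilde_ge0.
  apply: eq_lebint => xb /=; rewrite lebintZl ?Ktilde_ge0//.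
  exact: (measurable_fun_pair2 xb mgpw).
apply: le_lebint => w.
  by apply: sume_ge0 => i _; rewrite mule_ge0 ?lee_fin// mulr_ge0.
(* By disjointness at most one term of the sum is nonzero at [w]; if there is none, the bound is
   mere non-negativity. *)
have [[i Hw]|noH] := pselect (exists i : 'I_np, Hs Kn k q i.+1 w).
  rewrite (bigD1 i)//= big1 ?adde0.
    by rewrite indicE mem_set// mul1r -EFinM; exact: (lebint_Ktilde_ge (q := q)).
  move=> j ji; rewrite indicE memNset ?mul0r ?mule0// => Hj.
  suff : set0 w by [].
  rewrite -(disjH j.+1 i.+1) ?ltn_ord//.
rewrite big1; first by apply: lebint_ge0 => xb; rewrite mule_ge0// Ktilde_ge0.
move=> j _; rewrite indicE memNset ?mul0r ?mule0// => Hj.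
by apply: noH; exists j.
Qed.

Lemma Kaux_le_Vaux m q x : (m <= N)%N ->
  G `&` S = set0 -> (forall j, cell j `<=` G \/ cell j `<=` S) ->
  (forall k q' i, (N - m <= k < N)%N -> (1 <= i <= np)%N ->
    measurable (Hs (K np N sigma eta f pw pi G S cell z v k.+1) k q' i)) ->
  (forall k q' i j, (N - m <= k < N)%N -> (1 <= i <= np)%N ->
    (1 <= j <= np)%N -> i != j ->
    Hs (K np N sigma eta f pw pi G S cell z v k.+1) k q' i `&`
    Hs (K np N sigma eta f pw pi G S cell z v k.+1) k q' j = set0) ->
  cell q x ->
  (Kaux np N sigma eta f pw pi G S cell z v m q
     <= Vaux N sigma f pw pi G S m x)%E.
Proof.
move=> + GS0 cellGS; elim: m q x => [|m IH] q x mN mH disjH qx /=.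
  rewrite /indG; case: asboolP => [qG|_]; last by rewrite lee_fin.
  by rewrite indicE mem_set//; exact: qG.
have IHm q' x' : cell q' x' -> (Kaux np N sigma eta f pw pi G S cell z v m q'
     <= Vaux N sigma f pw pi G S m x')%E.
  have sub k : (N - m <= k)%N -> (N - m.+1 <= k)%N.
    by apply: leq_trans; rewrite leq_sub2l.
  apply: IH => [|k q'' i /andP[/sub km kN]|k q'' i j /andP[/sub km kN]].
  - exact: ltnW.
  - by apply: mH; rewrite km.
  - by apply: disjH; rewrite km.
set k := (N - m.+1)%N.
have kN : (N - m.+1 <= k < N)%N by rewrite leqnn /k ltn_subrL (leq_trans _ mN).
(* Since [m.+1 <= N], the truncated subtractions cancel: [N - k.+1 = m]. This links the hypotheses
   on [K] to the recursion of [Kaux]. *)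
have Kk : K np N sigma eta f pw pi G S cell z v k.+1 =
    Kaux np N sigma eta f pw pi G S cell z v m.
  by rewrite /K /k subnSK// subKn// ltnW.
have GSx : ~ (G x /\ S x) by move=> GSx; suff : set0 x by []; rewrite -GS0.
(* In a goal cell both sides equal 1, because disjointness of [G] and [S] kills the recursive terms;
   in a safe cell only those terms remain. *)
have [qG|qS] := cellGS q.
  have Gx := qG _ qx.
  rewrite /indG /indS asboolT// asboolF; last by move=> /(_ _ qx) Sx; exact: GSx.
  rewrite !indicE mem_set// memNset ?mul0e//; last by move=> Sx; exact: GSx.
have Sx := qS _ qx.
rewrite /indG /indS asboolF; last by move=> /(_ _ qx) Gx; exact: GSx.
rewrite asboolT// !indicE memNset ?mem_set//; last by move=> Gx; exact: GSx.
rewrite !mul1e !add0e.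
apply: (@le_trans _ _ (lebint (fun xb =>
    Kt (Kaux np N sigma eta f pw pi G S cell z v m) xb *
    pred_dens sigma f pw x (pi k x) xb))%E).
  apply: sum_Rterm_le => //.
  - exact: K_ge0.
  - by rewrite -Kk => i; exact: mH.
  - by rewrite -Kk => i j; exact: disjH.
(* Monotonicity for arbitrary non-negative functions suffices here: only the [Ktilde] side enters
   the Tonelli exchange. *)
apply: le_lebint => xb.
  by rewrite mule_ge0 ?pred_dens_ge0// Ktilde_ge0//; exact: K_ge0.
rewrite lee_wpmul2r ?pred_dens_ge0// /Ktilde; case: asboolP => [xbSG|_].
  by apply: IHm; exact: cell_z.
exact: V_ge0.
Qed.

End bnn_bounds.

Unset Implicit Arguments.
Set Strict Implicit.

Theorem theorem1 (R : realType) (n c nw nq np N : nat) (sigma eta : R)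
  (f : nw.-tuple R -> n.-tuple R -> c.-tuple R -> n.-tuple R)
  (pw : nw.-tuple R -> R)
  (U : set (c.-tuple R))
  (pi : nat -> n.-tuple R -> c.-tuple R)
  (G S : set (n.-tuple R))
  (cell : 'I_nq -> set (n.-tuple R))
  (z : n.-tuple R -> 'I_nq)
  (v : nat -> R)
  (k : nat) (q : 'I_nq) :
  (* the network is measurable in (w, x, u) *)
  measurable_fun [set: nw.-tuple R * n.-tuple R * c.-tuple R]
    (fun p => f p.1.1 p.1.2 p.2) ->
  (* p_w(. | D) is a probability density on R^{n_w} *)
  measurable_fun [set: nw.-tuple R] pw ->
  (forall w, 0 <= pw w) ->
  lebint (fun w : nw.-tuple R => (pw w)%:E) = 1%E ->
  0 < sigma ->
  (* U compact, strategy measurable with values in U *)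
  compact (row_of_tuple @` U) ->
  (forall k', measurable_fun [set: n.-tuple R] (pi k')) ->
  (forall k' x, U (pi k' x)) ->
  (* G, S measurable and disjoint *)
  measurable G -> measurable S -> G `&` S = set0 ->
  (* Q is a partition of S u G into measurable cells, each in G or in S *)
  (forall j, measurable (cell j)) ->
  (forall j, cell j !=set0) ->
  (forall i j, i != j -> cell i `&` cell j = set0) ->
  \bigcup_j cell j = S `|` G ->
  (forall j, cell j `<=` G \/ cell j `<=` S) ->
  (* z maps a state of S u G to the cell containing it *)
  (forall x, (S `|` G) x -> cell (z x) x) ->
  (* truncation level and thresholds *)
  0 < eta < 1 ->
  v 0%N = 0 -> v np = 1 -> (forall i, (i < np)%N -> v i <= v i.+1) ->
  (* the sets H are measurable *)
  (forall k' q' i, (k' < N)%N -> (1 <= i <= np)%N ->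
     measurable (Hset sigma eta f pi G S cell z v (K np N sigma eta f pw pi G S cell z v k'.+1) k' q' i)) ->
  (k <= N)%N ->
  (* pairwise disjointness assumption *)
  (forall k', (k <= k')%N -> (k' < N)%N -> forall (q'' : 'I_nq) (i j : nat),
     (1 <= i <= np)%N -> (1 <= j <= np)%N -> i != j ->
     Hset sigma eta f pi G S cell z v (K np N sigma eta f pw pi G S cell z v k'.+1) k' q'' i
     `&` Hset sigma eta f pi G S cell z v (K np N sigma eta f pw pi G S cell z v k'.+1) k' q'' j
     = set0) ->
  (K np N sigma eta f pw pi G S cell z v k q
     <= ereal_inf (V N sigma f pw pi G S k @` cell q))%E.
Proof.
move=> mf mpw pw0 _ sigma0 _ _ _ _ _ GS0 mcell _ disj_cell cover_cell cellGS
  cell_z eta01 v0 _ v_nd mH kN disjH.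
(* The thresholds increase from [v 0 = 0], but only up to index [np], hence the range
   restriction. *)
have v_ge0 i : (i <= np)%N -> 0 <= v i.
  elim: i => [|i IH] inp; first by rewrite v0.
  by rewrite (le_trans (IH (ltnW inp)))// v_nd.
apply: le_ereal_inf_tmp => _ [x qx <-].
apply: Kaux_le_Vaux => //; first exact: leq_subr.
- by move=> k' q' i /andP[_ k'N]; exact: mH.
- by move=> k' q' i j; rewrite subKn// => /andP[kk' k'N]; exact: disjH.
Qed.
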